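(* Let $A,\Delta A\in\mathbb{C}^{n\times n}$ be Hermitian and let $A(t)=A+t\,\Delta A$ for $t\in\mathbb{R}$. Let $r_1,\dots,r_k$ be positive integers with $r_1+\cdots+r_k=n$. Suppose that for all $t\in\mathbb{R}$ $$A(t)=U(t)\Lambda(t)U(t)^H,$$ where $U(t)=[U_1(t),\ldots,U_k(t)]$ with $U_j(t)\in\mathbb{C}^{n\times r_j}$ is unitary and analytic in $t$, $\Lambda(t)=\mathrm{diag}(\Lambda_1(t),\ldots,\Lambda_k(t))$ with $\Lambda_j(t)\in\mathbb{C}^{r_j\times r_j}$ is block diagonal and analytic in $t$ (the blocks $\Lambda_j(t)$ need not be diagonal), and $$U_j(t)^H\dot U_j(t)=0,\qquad j=1,\ldots,k .$$ For $j=1,\dots,k$ define $$\delta_{ji}(t)=\min_{\lambda_1\in\lambda(\Lambda_j(t)),\ \lambda_2\in\lambda(\Lambda_i(t))}|\lambda_1-\lambda_2|,\qquad \delta_j(t)=\min_{i\ne j}\delta_{ji}(t),\qquad \delta_{j,\min}=\min_{0\le t\le 1}\delta_j(t).$$ Put $\widetilde A=A(1)=A+\Delta A$, $U_j=U_j(0)$ and $\widetilde U_j=U_j(1)$ for $j=1,\dots,k$. Then $$\|\mathrm{Eig}^{\downarrow}(\widetilde A)-\mathrm{Eig}^{\downarrow}(A)\|_F^2+\sum_{j=1}^k\delta_{j,\min}^2\,\|\widetilde U_j-U_j\|_F^2\le\|\Delta A\|_F^2 .$$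
   Context: $X^H$ is the conjugate transpose, $\|\cdot\|_F$ the Frobenius norm, $\lambda(X)$ the spectrum of a square matrix $X$, and $\dot F(t)=dF(t)/dt$. ''Analytic'' means real-analytic in the real variable $t$ (entrywise). For an $n\times n$ Hermitian matrix $X$, $\mathrm{Eig}^{\downarrow}(X)$ denotes the $n\times n$ diagonal matrix whose diagonal entries are the eigenvalues of $X$ (with multiplicity) in nonincreasing order. Convention for $k=1$: a minimum over the empty set is $+\infty$, and in that case the term $\delta_{1,\min}^2\|\widetilde U_1-U_1\|_F^2$ is read as $0$ (one has $\widetilde U_1=U_1$ because $U_1(t)^H\dot U_1(t)=0$). *)

(* Defs.v *)
From HB Require Import structures.
From mathcomp Require Import all_boot all_order all_algebra.
From mathcomp Require Import complex.
From mathcomp Require Import all_classical all_reals all_analysis.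

Set Implicit Arguments.
Unset Strict Implicit.
Unset Printing Implicit Defensive.

Import Order.TTheory GRing.Theory Num.Theory.
Import numFieldNormedType.Exports.

Local Open Scope classical_set_scope.
Local Open Scope complex_scope.
Local Open Scope ring_scope.

Definition real_analytic (R : realType) (f : R -> R) : Prop :=
  forall t0 : R, exists2 e : R, 0 < e &
    exists c : nat -> R, forall t : R, `|t - t0| < e ->
      pseries c (t - t0) @ \oo --> f t.

(* A complex-valued function of a real variable is the sum of a complex power
   series near each point iff its real and imaginary parts are analytic. *)
Definition mx_analytic (R : realType) (m p : nat)
    (F : R -> 'M[R[i]]_(m, p)) : Prop :=
  forall i j, real_analytic (fun t => complex.Re (F t i j)) /\
              real_analytic (fun t => complex.Im (F t i j)).

Definition mx_deriv (R : realType) (m p : nat)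
    (F : R -> 'M[R[i]]_(m, p)) (t : R) : 'M[R[i]]_(m, p) :=
  \matrix_(i, j) (derive1 (fun s => complex.Re (F s i j)) t +i*
                  derive1 (fun s => complex.Im (F s i j)) t).

Definition frobenius (R : realType) (m p : nat) (X : 'M[R[i]]_(m, p)) : R :=
  Num.sqrt (\sum_i \sum_j (Normc.normc (X i j)) ^+ 2).

Definition spectrum (R : realType) (m : nat) (X : 'M[R[i]]_m) : set R[i] :=
  [set a | eigenvalue X a].

(* Eigenvalues with (algebraic) multiplicity, in an unspecified order. *)
Definition eigen_seq (R : realType) (m : nat) (X : 'M[R[i]]_m) : seq R[i] :=
  sval (closed_field_poly_normal (char_poly X)).

(* Meant for Hermitian X: the eigenvalues are then real, and taking real parts
   only serves to compare them in the total order of R. *)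
Definition eig_down (R : realType) (m : nat) (X : 'M[R[i]]_m) : 'M[R[i]]_m :=
  diag_mx (\row_(i < m)
    (nth 0 (sort (fun x y : R => y <= x)
                 (map (@complex.Re R) (eigen_seq X))) i)%:C).

(* The infimum is over a nonempty finite set as soon as 0 < m and 0 < p, hence
   it is then a finite minimum. *)
Definition gap (R : realType) (m p : nat)
    (X : 'M[R[i]]_m) (Y : 'M[R[i]]_p) : \bar R :=
  ereal_inf [set (Normc.normc (l1 - l2))%:E |
               l1 in spectrum X & l2 in spectrum Y].

(* Equal to +oo when k = 1. *)
Definition delta (R : realType) (k : nat) (r : 'I_k -> nat)
    (Lambda : forall j : 'I_k, R -> 'M[R[i]]_(r j)) (j : 'I_k) (t : R) :
    \bar R :=
  \big[Order.min/+oo%E]_(i < k | i != j) gap (Lambda j t) (Lambda i t).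

(* When the Lambda j are continuous, with real spectra and positive sizes, each
   delta j is continuous (or constantly +oo), so this infimum over a compact
   interval is attained. *)
Definition delta_min (R : realType) (k : nat) (r : 'I_k -> nat)
    (Lambda : forall j : 'I_k, R -> 'M[R[i]]_(r j)) (j : 'I_k) : \bar R :=
  ereal_inf [set delta Lambda j t | t in `[0, 1]].

(* Main.v *)
Require Import Defs.
From HB Require Import structures.
From mathcomp Require Import all_boot all_order all_algebra.
From mathcomp Require Import perm.
From mathcomp Require Import ring lra.
From mathcomp Require Import complex.
From mathcomp Require Import all_classical all_reals all_analysis.

Set Implicit Arguments.
Unset Strict Implicit.
Unset Printing Implicit Defensive.

Import Order.TTheory GRing.Theory Num.Theory.
Import numFieldNormedType.Exports.

Local Open Scope classical_set_scope.
Local Open Scope complex_scope.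
Local Open Scope sesquilinear_scope.
Local Open Scope ring_scope.

(** The equation [A(t) U_j = U_j L_j], where [L_j] is the block [Lambda j t],
    differentiates to
    [dA U_j + A(t) U_j' = U_j' L_j + U_j L_j']. Multiplied on the left by the
    adjoint of [U_i], and with [K_ij = U_i^H U_j'], it gives
    [U_i^H dA U_j = K_ij L_j - L_i K_ij] for [i != j], and
    [U_j^H dA U_j = L_j'] since [K_jj = 0] by hypothesis. The blocks
    [U_i^H dA U_j] share out the squared norm of [dA], the blocks [K_ij] that
    of [U_j'], and [K |-> K L_j - L_i K] expands Frobenius norms at least by
    the gap between the spectra ([gap_sylvester]). So at every time
    [\sum_j |L_j'|^2 + \sum_j delta_j^2 |U_j'|^2 <= |dA|^2]
    ([offdiag_sylvester_bound]).

    A curve whose speed is bounded by [|dA|] in a Euclidean norm moves by at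
    most [|dA|] in unit time ([mean_value_frobenius]); applied to the curve
    [(L_j, delta_j,min U_j)_j] this bounds
    [|L(1) - L(0)|^2 + \sum_j delta_j,min^2 |U_j(1) - U_j(0)|^2]. Finally
    [L(t)] is unitarily similar to [A(t)], and the distance of two Hermitian
    matrices is at least that of their sorted eigenvalues
    ([hoffman_wielandt]), which turns [|L(1) - L(0)|] into the eigenvalue
    term.

    Analyticity supplies the derivatives ([real_analytic_derivable]), and an
    infinite [delta_j,min] is reduced to finite weights
    ([ereal_weighted_sum_le]). *)

(** * Real and imaginary parts, adjoints and the Frobenius form *)

(** Additivity of [complex.Re] is declared on the copy [Rcomplex R] of [R[i]];
    hence the cast. *)
Lemma Re_sum (R : realType) (I : finType) (P : pred I) (F : I -> R[i]) :
  complex.Re (\sum_(i | P i) F i) = \sum_(i | P i) complex.Re (F i).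
Proof. exact: (raddf_sum (@complex.Re R : {additive Rcomplex R -> R})). Qed.

Lemma Im_sum (R : realType) (I : finType) (P : pred I) (F : I -> R[i]) :
  complex.Im (\sum_(i | P i) F i) = \sum_(i | P i) complex.Im (F i).
Proof. exact: (raddf_sum (@complex.Im R : {additive Rcomplex R -> R})). Qed.

Lemma ReD (R : realType) (x y : R[i]) :
  complex.Re (x + y) = complex.Re x + complex.Re y.
Proof. by case: x y => [a b] [c d]. Qed.

Lemma ImD (R : realType) (x y : R[i]) :
  complex.Im (x + y) = complex.Im x + complex.Im y.
Proof. by case: x y => [a b] [c d]. Qed.

Lemma ReN (R : realType) (x : R[i]) : complex.Re (- x) = - complex.Re x.
Proof. by case: x. Qed.

Lemma ReM (R : realType) (x y : R[i]) : complex.Re (x * y) =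
  complex.Re x * complex.Re y - complex.Im x * complex.Im y.
Proof. by case: x y => [a b] [c d]. Qed.

Lemma ImM (R : realType) (x y : R[i]) : complex.Im (x * y) =
  complex.Re x * complex.Im y + complex.Im x * complex.Re y.
Proof. by case: x y => [a b] [c d]. Qed.

Lemma sqr_normc (R : realType) (x : R[i]) :
  Normc.normc x ^+ 2 = complex.Re x ^+ 2 + complex.Im x ^+ 2.
Proof. by case: x => a b /=; rewrite sqr_sqrtr // addr_ge0 ?sqr_ge0. Qed.

Lemma adjmx_mul (R : realType) m n p (X : 'M[R[i]]_(m, n)) (Y : 'M[R[i]]_(n, p)) :
  (X *m Y)^t* = Y^t* *m X^t*.
Proof. by rewrite trmx_mul map_mxM. Qed.

Lemma unitarymxPl (R : realType) n (P : 'M[R[i]]_n) :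
  P \is unitarymx -> P^t* *m P = 1%:M.
Proof. by move=> Pu; rewrite -[LHS]mul1mx mulmxA mulmxKtV. Qed.

Lemma hermsymmxE (R : realType) n (X : 'M[R[i]]_n) :
  (X \is hermsymmx) = (X == X^t*).
Proof. by rewrite qualifE /= expr0 scale1r. Qed.

Section FrobeniusForm.
Variable R : realType.

(** The Euclidean inner product of [C^(m x n)] seen as a real vector space.
    The trace form makes unitary invariance immediate; the entrywise form
    [rdotE] is the one to differentiate. *)
Definition rdot m n (X Y : 'M[R[i]]_(m, n)) : R :=
  complex.Re (\tr (X *m Y^t*)).

Lemma rdotE m n (X Y : 'M[R[i]]_(m, n)) :
  rdot X Y = \sum_i \sum_j (complex.Re (X i j) * complex.Re (Y i j) +
                            complex.Im (X i j) * complex.Im (Y i j)).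
Proof.
rewrite /rdot /mxtrace Re_sum; apply: eq_bigr => i _.
rewrite mxE Re_sum; apply: eq_bigr => j _.
by rewrite !mxE; case: (X i j) (Y i j) => [a b] [c d] /=; rewrite mulrN opprK.
Qed.

Lemma frobeniusE m n (X : 'M[R[i]]_(m, n)) :
  frobenius X ^+ 2 = \sum_i \sum_j (Normc.normc (X i j)) ^+ 2.
Proof.
rewrite sqr_sqrtr //; apply: sumr_ge0 => i _; apply: sumr_ge0 => j _.
exact: sqr_ge0.
Qed.

Lemma rdotXX m n (X : 'M[R[i]]_(m, n)) : rdot X X = frobenius X ^+ 2.
Proof.
rewrite frobeniusE rdotE; apply: eq_bigr => i _; apply: eq_bigr => j _.
by rewrite sqr_normc !expr2.
Qed.

Lemma rdotBl m n (X Y Z : 'M[R[i]]_(m, n)) :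
  rdot (X - Y) Z = rdot X Z - rdot Y Z.
Proof. by rewrite /rdot mulmxBl raddfB /= ReD ReN. Qed.

(** Expansion of [0 <= frobenius (X - Y) ^+ 2]; it replaces Cauchy-Schwarz
    throughout, which avoids square roots. *)
Lemma rdot_le m n (X Y : 'M[R[i]]_(m, n)) :
  2 * rdot X Y <= frobenius X ^+ 2 + frobenius Y ^+ 2.
Proof.
rewrite -!rdotXX !rdotE mulr_sumr -big_split ler_sum //= => i _.
rewrite mulr_sumr -big_split ler_sum //= => j _.
move: (complex.Re _) (complex.Im _) (complex.Re _) (complex.Im _) => a b c d.
have := sqr_ge0 (a - c); have := sqr_ge0 (b - d); nra.
Qed.

Lemma frobenius_unitary m n (P : 'M[R[i]]_m) (Q : 'M[R[i]]_n) (X : 'M[R[i]]_(m, n)) :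
  P \is unitarymx -> Q \is unitarymx ->
  frobenius (P *m X *m Q) ^+ 2 = frobenius X ^+ 2.
Proof.
move=> /unitarymxPl PP /unitarymxP Qu; rewrite -!rdotXX /rdot !adjmx_mul.
rewrite !mulmxA -(mulmxA (P *m X) Q) Qu mulmx1 -!mulmxA mxtrace_mulC.
by rewrite -!mulmxA PP mulmx1.
Qed.

(** Parseval: the column blocks [V j] need only resolve the identity. Stated
    blockwise, this spares any index computation inside block matrices. *)
Lemma frobenius_parseval m k (r : 'I_k -> nat) n
    (V : forall j, 'M[R[i]]_(m, r j)) (X : 'M[R[i]]_(m, n)) :
  \sum_j V j *m (V j)^t* = 1%:M ->
  \sum_j frobenius ((V j)^t* *m X) ^+ 2 = frobenius X ^+ 2.
Proof.
move=> VV; rewrite -rdotXX /rdot -[X in X *m _]mul1mx -VV.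
rewrite !mulmx_suml (raddf_sum (@mxtrace R[i] m)) Re_sum; apply: eq_bigr => j _.
rewrite -rdotXX /rdot adjmx_mul trmxCK; congr (complex.Re _).
rewrite -!mulmxA [RHS]mxtrace_mulC.
by rewrite -!mulmxA.
Qed.

Lemma frobenius_adjoint m n (X : 'M[R[i]]_(m, n)) :
  frobenius (X^t*) ^+ 2 = frobenius X ^+ 2.
Proof. by rewrite -!rdotXX /rdot trmxCK mxtrace_mulC. Qed.

Definition realdiag n (e : 'I_n -> R) : 'M[R[i]]_n :=
  diag_mx (\row_i (e i)%:C).

(** In the eigenbases of the two Hermitian coefficients the Sylvester operator
    [K |-> K Y - X K] is diagonal, with multipliers the eigenvalue differences.
    Both the gap estimate and, for [K = 1], the Hoffman-Wielandt inequality
    are read off this formula. *)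
Lemma frobenius_sylvester p q (P : 'M[R[i]]_p) (Q : 'M[R[i]]_q)
    (b : 'I_p -> R) (c : 'I_q -> R) (K : 'M[R[i]]_(p, q)) :
  P \is unitarymx -> Q \is unitarymx ->
  frobenius (K *m (Q^t* *m realdiag c *m Q) -
             (P^t* *m realdiag b *m P) *m K) ^+ 2 =
  \sum_i \sum_j (c j - b i) ^+ 2 *
     Normc.normc ((P *m K *m Q^t*) i j) ^+ 2.
Proof.
move=> Pu Qu; set W := P *m K *m Q^t*.
have PP := unitarymxPl Pu; have QQ := unitarymxPl Qu.
have P'u : P^t* \is unitarymx by rewrite trmxC_unitary.
have -> : K *m (Q^t* *m realdiag c *m Q) - (P^t* *m realdiag b *m P) *m K =
    P^t* *m (W *m realdiag c - realdiag b *m W) *m Q.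
  rewrite /W mulmxBr mulmxBl !mulmxA PP mul1mx; congr (_ - _).
  by rewrite -!mulmxA QQ mulmx1.
rewrite (frobenius_unitary _ P'u Qu) frobeniusE.
apply: eq_bigr => i _; apply: eq_bigr => j _.
rewrite /realdiag mul_mx_diag mul_diag_mx !mxE [_%:C * _]mulrC -mulrBr.
rewrite -rmorphB Normc.normcM exprMn mulrC; congr (_ * _).
by rewrite sqr_normc /= expr0n addr0.
Qed.

End FrobeniusForm.

(** * Spectra of Hermitian matrices *)

Section Hermitian.
Variable R : realType.

Lemma hermitian_spectral n (X : 'M[R[i]]_n) : X \is hermsymmx ->
  exists2 P : 'M[R[i]]_n, P \is unitarymx &
    exists e : 'I_n -> R, X = P^t* *m realdiag e *m P.
Proof.
move=> Xh; exists (spectralmx X); first exact: spectral_unitarymx.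
exists (fun i => complex.Re (spectral_diag X 0 i)).
have /orthomx_spectralP XE := hermitian_normalmx Xh; rewrite [LHS]XE.
congr (_ *m diag_mx _ *m _).
  exact: invmx_unitary (spectral_unitarymx X).
apply/rowP => i; rewrite mxE RRe_real //.
exact: (mxOverP (hermitian_spectral_diag_real Xh)).
Qed.

Lemma spectrum_realdiag n (P : 'M[R[i]]_n) (e : 'I_n -> R) i :
  P \is unitarymx -> spectrum (P^t* *m realdiag e *m P) (e i)%:C.
Proof.
move=> Pu; apply/eigenvalueP; exists (row i P).
  rewrite !mulmxA -row_mul (unitarymxP Pu) row1 -rowE /realdiag.
  by rewrite row_diag_mx mxE -scalemxAl -rowE.
apply/eqP => Pi0; have /row_unitarymxP/(_ i i) := Pu.
by rewrite Pi0 linear0l eqxx => /eqP; rewrite eq_sym oner_eq0.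
Qed.

(** Each multiplier [c j - b i] of [frobenius_sylvester] is a difference of
    eigenvalues of [Y] and [X], hence at least the gap in absolute value. *)
Lemma gap_sylvester p q (X : 'M[R[i]]_p) (Y : 'M[R[i]]_q)
    (K : 'M[R[i]]_(p, q)) (d : R) :
  X \is hermsymmx -> Y \is hermsymmx -> 0 <= d -> (d%:E <= gap Y X)%E ->
  d ^+ 2 * frobenius K ^+ 2 <= frobenius (K *m Y - X *m K) ^+ 2.
Proof.
move=> /hermitian_spectral[P Pu [b Xe]] /hermitian_spectral[Q Qu [c Ye]].
move=> d0 dgap; rewrite Xe Ye frobenius_sylvester //.
rewrite -(frobenius_unitary _ Pu (_ : Q^t* \is unitarymx)) ?trmxC_unitary //.
rewrite frobeniusE mulr_sumr ler_sum // => i _.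
rewrite mulr_sumr ler_sum // => j _; rewrite ler_wpM2r ?sqr_ge0 //.
rewrite -[leRHS]real_normK ?num_real // lerXn2r // ?nnegrE //.
rewrite -lee_fin (le_trans dgap) //.
apply: ereal_inf_lbound; exists (c j)%:C; first by rewrite Ye; exact: spectrum_realdiag.
exists (b i)%:C; first by rewrite Xe; exact: spectrum_realdiag.
by rewrite -rmorphB /= expr0n addr0 sqrtr_sqr.
Qed.

Lemma char_poly_unitary n (P M : 'M[R[i]]_n) : P \is unitarymx ->
  char_poly (P^t* *m M *m P) = char_poly M.
Proof.
move=> Pu; rewrite /char_poly /char_poly_mx.
have PP : map_mx polyC (P^t*) *m map_mx polyC P = 1%:M.
  by rewrite -map_mxM unitarymxPl // map_mx1.
have -> : 'X%:M - map_mx polyC (P^t* *m M *m P) =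
    map_mx polyC (P^t*) *m ('X%:M - map_mx polyC M) *m map_mx polyC P.
  rewrite mulmxBr mulmxBl !map_mxM; congr (_ - _).
  by rewrite scalar_mxC -mulmxA PP mulmx1.
by rewrite !det_mulmx mulrAC -det_mulmx PP det1 mul1r.
Qed.

Definition eig_seq n (X : 'M[R[i]]_n) : seq R :=
  sort (fun x y : R => y <= x) (map (@complex.Re R) (eigen_seq X)).

Lemma eig_downE n (X : 'M[R[i]]_n) :
  eig_down X = realdiag (fun i => nth 0 (eig_seq X) i).
Proof. by []. Qed.

(** [eigen_seq] is chosen from the characteristic polynomial alone, so unitarily
    similar matrices have literally the same sorted sequence. *)
Lemma eig_seq_unitary n (P X : 'M[R[i]]_n) : P \is unitarymx ->
  eig_seq (P^t* *m X *m P) = eig_seq X.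
Proof. by move=> Pu; rewrite /eig_seq /eigen_seq char_poly_unitary. Qed.

Lemma char_poly_eigen_seq n (X : 'M[R[i]]_n) :
  char_poly X = \prod_(z <- eigen_seq X) ('X - z%:P).
Proof.
rewrite /eigen_seq; case: (closed_field_poly_normal _) => s /= {1}->.
by rewrite (monicP (char_poly_monic _)) scale1r.
Qed.

Lemma eig_seq_realdiag n (e : 'I_n -> R) :
  perm_eq (eig_seq (realdiag e)) [tuple e i | i < n].
Proof.
rewrite /eig_seq perm_sort.
suff /(perm_map (@complex.Re R)) : perm_eq (eigen_seq (realdiag e))
    (map (real_complex R) [tuple e i | i < n]).
  by rewrite -map_comp [X in perm_eq _ X]map_id_in.
apply: prod_XsubC_eq; rewrite -char_poly_eigen_seq.
rewrite char_poly_trig ?diag_mx_is_trig // big_map big_map.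
rewrite big_enum /=.
by apply: eq_bigr => i _; rewrite !mxE eqxx mulr1n.
Qed.

Lemma eig_seq_noninc n (X : 'M[R[i]]_n) i j : (i <= j < size (eig_seq X))%N ->
  nth 0 (eig_seq X) j <= nth 0 (eig_seq X) i.
Proof.
move=> /andP[ij js].
have s : sorted (fun x y : R => y <= x) (eig_seq X).
  by apply: sort_sorted => x y; exact: le_total.
apply: (sorted_leq_nth _ _ 0 s) => //.
- by move=> x y z /= yx xz; exact: le_trans xz yx.
- by rewrite inE (leq_ltn_trans ij).
Qed.

(** The spectral theorem with the eigenvalues put in nonincreasing order: a
    permutation sorting them is absorbed in the unitary factor. The size
    equation ensures that [eig_down] never reads the default value of [nth]. *)
Lemma hermitian_eig_down n (X : 'M[R[i]]_n) : X \is hermsymmx ->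
  size (eig_seq X) = n /\
  exists2 P : 'M[R[i]]_n, P \is unitarymx & X = P^t* *m eig_down X *m P.
Proof.
move=> /hermitian_spectral[P Pu [e Xe]].
have se : perm_eq (eig_seq X) [tuple e i | i < n].
  by rewrite Xe eig_seq_unitary // eig_seq_realdiag.
split; first by rewrite (perm_size se) size_tuple.
have /tuple_permP[s sE] := se.
have Su : perm_mx s \is @unitarymx R[i] n n.
  apply/unitarymxP; rewrite tr_perm_mx map_perm_mx -perm_mxM.
  by rewrite mulgV perm_mx1.
exists (perm_mx s *m P); first exact: mul_unitarymx Su Pu.
have -> : eig_down X = perm_mx s *m realdiag e *m (perm_mx s)^t*.
  rewrite eig_downE -row_permE tr_perm_mx map_perm_mx -col_permE.
  apply/matrixP => i j; rewrite !mxE sE (inj_eq perm_inj).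
  by rewrite (nth_map i) ?size_enum_ord // nth_ord_enum !tnth_mktuple.
have SS := unitarymxPl Su.
rewrite adjmx_mul !mulmxA -(mulmxA (P^t*)) SS mulmx1.
by rewrite -(mulmxA (_ *m realdiag e)) SS mulmx1.
Qed.

End Hermitian.

(** * The Hoffman-Wielandt inequality *)

Section HoffmanWielandt.
Variable R : realType.

(** A dual solution of the transport problem with cost [- b i * c j]. The points
    [(b i, u i)] lie on the graph of a convex function of slope [c l] between
    [b l.+1] and [b l], and the inequality says that this graph is above
    its supporting lines. Such a [u] certifies that the identity matching
    of two sorted sequences is optimal among doubly stochastic ones,
    without decomposing these into permutations. *)
Lemma supporting_potential n (b c : nat -> R) :
  (forall i j, (i <= j < n)%N -> b j <= b i) ->
  (forall i j, (i <= j < n)%N -> c j <= c i) ->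
  exists u : nat -> R, forall i j, (i < n)%N -> (j < n)%N ->
    (b i - b j) * c j <= u i - u j.
Proof.
move=> bdec cdec.
exists (fun i => \sum_(0 <= l < i) (b l.+1 - b l) * c l) => i j.
have [/subnKC <-|/ltnW/subnKC <-] := leqP j i; [move: (i - j)%N|move: (j - i)%N].
- elim=> [|m IHm]; first by rewrite addn0 !subrr mul0r.
  rewrite addnS => mn jn; rewrite big_nat_recr //=.
  have IH := IHm (ltnW mn) jn.
  have db : 0 <= b (j + m)%N - b (j + m).+1 by rewrite subr_ge0 bdec // leqnSn.
  have dc : 0 <= c j - c (j + m)%N by rewrite subr_ge0 cdec // leq_addr ltnW.
  have := mulr_ge0 db dc; lra.
- elim=> [|m IHm]; first by rewrite addn0 !subrr mul0r.
  rewrite addnS => im mn; rewrite big_nat_recr //=.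
  have IH := IHm im (ltnW mn).
  have db : 0 <= b i - b (i + m).+1 by rewrite subr_ge0 bdec // mn -addnS leq_addr.
  have dc : 0 <= c (i + m)%N - c (i + m).+1 by rewrite subr_ge0 cdec // leqnSn.
  have := mulr_ge0 db dc; lra.
Qed.

Lemma normc_unitary_row n (W : 'M[R[i]]_n) i : W \is unitarymx ->
  \sum_j Normc.normc (W i j) ^+ 2 = 1.
Proof.
move=> /unitarymxP /matrixP/(_ i i); rewrite !mxE eqxx => /(congr1 (@complex.Re R)).
rewrite Re_sum /= => <-; apply: eq_bigr => j _.
by rewrite !mxE sqr_normc; case: (W i j) => x y /=; rewrite mulrN opprK !expr2.
Qed.

Lemma normc_unitary_col n (W : 'M[R[i]]_n) j : W \is unitarymx ->
  \sum_i Normc.normc (W i j) ^+ 2 = 1.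
Proof.
rewrite -trmxC_unitary => /(@normc_unitary_row _ _ j) <-.
apply: eq_bigr => i _; rewrite !mxE !sqr_normc; case: (W i j) => x y /=.
by rewrite sqrrN.
Qed.

Lemma frobenius_realdiagB n (b c : 'I_n -> R) :
  frobenius (realdiag c - realdiag b) ^+ 2 = \sum_(i < n) (c i - b i) ^+ 2.
Proof.
rewrite frobeniusE; apply: eq_bigr => i _; rewrite (bigD1 i) //= big1 ?addr0.
  by rewrite !mxE eqxx !mulr1n -rmorphB sqr_normc /= expr0n addr0.
move=> j ji; rewrite !mxE eq_sym (negbTE ji) !mulr0n subrr.
by rewrite Normc.normc0 expr0n.
Qed.

(** By [frobenius_sylvester] with [K = 1], the right-hand side is
    [\sum_ij (c j - b i) ^+ 2 * S i j], where the [S i j] are the squared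
    moduli of the entries of a unitary matrix and hence form a doubly
    stochastic matrix. The potential bounds [(c j - b i) ^+ 2] below by
    [f i + g j], with equality for [i = j]; the sum of [(f i + g j) * S i j]
    depends on [S] only through its row and column sums, so it is the same as
    for the identity. *)
Lemma frobenius_sorted_realdiag n (P Q : 'M[R[i]]_n) (b c : nat -> R) :
  P \is unitarymx -> Q \is unitarymx ->
  (forall i j, (i <= j < n)%N -> b j <= b i) ->
  (forall i j, (i <= j < n)%N -> c j <= c i) ->
  frobenius (realdiag (fun i : 'I_n => c i) - realdiag (fun i : 'I_n => b i)) ^+ 2
  <= frobenius (Q^t* *m realdiag (fun i : 'I_n => c i) *m Q -
                P^t* *m realdiag (fun i : 'I_n => b i) *m P) ^+ 2.
Proof.
move=> Pu Qu bdec cdec; have [u uP] := supporting_potential bdec cdec.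
have Wu : P *m Q^t* \is unitarymx.
  by apply: mul_unitarymx Pu _; rewrite trmxC_unitary.
have := frobenius_sylvester (fun i : 'I_n => b i) (fun i : 'I_n => c i) 1%:M Pu Qu.
rewrite !mulmx1 mul1mx => ->; rewrite frobenius_realdiagB.
move: (P *m Q^t*) Wu => W Wu; pose S i j := Normc.normc (W i j) ^+ 2.
pose f i := b i ^+ 2 - 2 * u i.
pose g i := c i ^+ 2 - 2 * (b i * c i) + 2 * u i.
have -> : \sum_(i < n) (c i - b i) ^+ 2 =
    \sum_(i < n) \sum_(j < n) (f i + g j) * S i j.
  transitivity (\sum_(i < n) f i + \sum_(i < n) g i).
    by rewrite -big_split; apply: eq_bigr => i _; rewrite /f /g /=; ring.
  have -> : \sum_(i < n) \sum_(j < n) (f i + g j) * S i j =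
      \sum_(i < n) \sum_(j < n) f i * S i j +
      \sum_(i < n) \sum_(j < n) g j * S i j.
    rewrite -big_split; apply: eq_bigr => i _; rewrite -big_split.
    by apply: eq_bigr => j _; rewrite mulrDl.
  congr (_ + _).
    by apply: eq_bigr => i _; rewrite -mulr_sumr (normc_unitary_row i Wu) mulr1.
  rewrite exchange_big; apply: eq_bigr => j _ /=.
  by rewrite -mulr_sumr (normc_unitary_col j Wu) mulr1.
rewrite ler_sum // => i _; rewrite ler_sum // => j _.
rewrite ler_wpM2r ?sqr_ge0 //.
have := uP i j (ltn_ord i) (ltn_ord j); rewrite /f /g.
by move: (b i) (b j) (c j) (u i) (u j) => x y z v w; lra.
Qed.

Theorem hoffman_wielandt n (X Y : 'M[R[i]]_n) :
  X \is hermsymmx -> Y \is hermsymmx ->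
  frobenius (eig_down Y - eig_down X) ^+ 2 <= frobenius (Y - X) ^+ 2.
Proof.
move=> /hermitian_eig_down[Xs [P Pu Xe]] /hermitian_eig_down[Ys [Q Qu Ye]].
rewrite [in leRHS]Xe [in leRHS]Ye; apply: frobenius_sorted_realdiag => // i j ij.
  by apply: eig_seq_noninc; rewrite Xs.
by apply: eig_seq_noninc; rewrite Ys.
Qed.

End HoffmanWielandt.

(** * Analytic functions are differentiable *)

Section Calculus.
Variable R : realType.

(** Two factors [h] come out of the terms of order at least 2, and what remains
    is dominated by the absolutely convergent series at [rho]. *)
Lemma pseries_remainder (c : nat -> R) (rho S h L : R) :
  0 < rho -> `|h| <= rho ->
  (forall n, pseries (fun i => `|c i|) rho n <= S) ->
  pseries c h @ \oo --> L ->
  `|L - c 0%N - c 1%N * h| <= S / rho ^+ 2 * `|h| ^+ 2.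
Proof.
move=> rho0 hrho SP cL.
have cL2 : `|pseries c h (n + 2)%N - c 0%N - c 1%N * h| @[n --> \oo] -->
    `|L - c 0%N - c 1%N * h|.
  apply: cvg_norm; apply: cvgB; last exact: cvg_cst.
  apply: cvgB; last exact: cvg_cst.
  by rewrite (cvg_shiftn 2 (pseries c h)).
rewrite -(cvg_lim _ cL2) //; apply: limr_le; first by apply/cvg_ex; eexists; exact: cL2.
apply: nearW => n; rewrite addn2 /pseries /series /= !big_nat_recl //=.
rewrite expr0 mulr1 expr1 -addrA -opprD addrA addrAC subrr add0r.
apply: le_trans (ler_norm_sum _ _ _) _.
apply: (@le_trans _ _ (\sum_(0 <= i < n)
    `|c i.+2| * rho ^+ i.+2 / rho ^+ 2 * `|h| ^+ 2)).
  apply: ler_sum => i _; rewrite normrM normrX -[leRHS]mulrA -[leRHS]mulrA ler_wpM2l //.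
  have r0 : rho ^+ 2 != 0 by rewrite expf_neq0 ?gt_eqF.
  rewrite -(addn2 i) !exprD -mulrA mulVKf //.
  by rewrite ler_wpM2r ?exprn_ge0 // lerXn2r // ?nnegrE // ltW.
rewrite -mulr_suml -mulr_suml ler_wpM2r ?exprn_ge0 //.
apply: ler_wpM2r; first by rewrite invr_ge0 exprn_ge0 // ltW.
apply: le_trans (SP n.+2).
rewrite /pseries /series /= !big_nat_recl //= addrA lerDr.
by rewrite addr_ge0 // mulr_ge0 // exprn_ge0 // ltW.
Qed.

(** Since analyticity provides an expansion centred at every point, only the
    derivative at the centre is needed, and the second-order remainder
    estimate gives it: no termwise differentiation is involved. *)
Lemma real_analytic_derivable (f : R -> R) (t : R) :
  real_analytic f -> derivable f t 1.
Proof.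
move=> /(_ t)[e e0 [c fE]].
pose rho := e / 3; have rho0 : 0 < rho by rewrite divr_gt0.
pose S := limn (pseries (fun i => `|c i|) rho).
have SP n : pseries (fun i => `|c i|) rho n <= S.
  apply: nondecreasing_cvgn_le.
    apply/nondecreasing_seqP => m; rewrite /pseries /series /= big_nat_recr //=.
    by rewrite lerDl mulr_ge0 // exprn_ge0 // ltW.
  (* Absolute convergence at [e / 3] comes from plain convergence at [e / 2]. *)
  apply: (@is_cvg_pseries_inside_norm _ c (e / 2)).
    apply/cvg_ex; exists (f (t + e / 2)).
    have := fE (t + e / 2); rewrite addrAC subrr add0r; apply.
    by rewrite gtr0_norm ?divr_gt0 //; lra.
  by rewrite !gtr0_norm ?divr_gt0 // /rho; lra.
have rem h : `|h| <= rho ->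
    `|f (t + h) - c 0%N - c 1%N * h| <= S / rho ^+ 2 * `|h| ^+ 2.
  move=> hr; apply: pseries_remainder => //.
  have := fE (t + h); rewrite addrAC subrr add0r; apply.
  by apply: le_lt_trans hr _; rewrite /rho; lra.
have ft : f t = c 0%N.
  have := rem 0; rewrite normr0 addr0 mulr0 subr0 expr0n mulr0 => /(_ (ltW rho0)).
  by rewrite normr_le0 subr_eq0 => /eqP.
suff : is_derive t 1 f (c 1%N) by move=> ?; exact: ex_derive.
apply/is_derive1_caratheodory.
exists (fun z => if z == t then c 1%N else (f z - f t) / (z - t)); split.
- move=> z; case: eqVneq => [->|zt]; first by rewrite !subrr mulr0.
  by rewrite divfK // subr_eq0.
- pose C := S / rho ^+ 2.
  have C0 : 0 <= C.
    apply: divr_ge0; last by rewrite exprn_ge0 // ltW.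
    apply: le_trans (SP 0%N).
    by rewrite /pseries /series /= big_geq.
  apply/cvgrPdist_le => eps eps0; near=> z; rewrite /= eqxx.
  case: eqVneq => [_|zt]; first by rewrite subrr normr0 ltW.
  have z0 : z - t != 0 by rewrite subr_eq0.
  have zr : `|z - t| <= Num.min rho (eps / (C + 1)).
    near: z; apply: filterS (nbhsx_ballx t _ _) => [z|].
      by rewrite /ball /= distrC => /ltW; exact.
    by rewrite lt_min rho0 divr_gt0 // ltr_wpDl.
  move: zr; rewrite le_min => /andP[zr ze].
  have -> : c 1%N - (f z - f t) / (z - t) =
      - ((f (t + (z - t)) - c 0%N - c 1%N * (z - t)) / (z - t)).
    by rewrite ft [t + _]addrC subrK; field.
  rewrite normrN normrM normfV ler_pdivrMr ?normr_gt0 //.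
  apply: le_trans (rem _ zr) _; rewrite -/C expr2 mulrA ler_wpM2r //.
  rewrite ler_pdivlMr ?ltr_wpDl // in ze.
  by rewrite (le_trans _ ze) // mulrC ler_wpM2l // lerDl.
- by rewrite eqxx.
Unshelve. all: by end_near.
Qed.

End Calculus.

(** * Derivatives of complex matrix functions of a real variable *)

Section MatrixDerivative.
Variable R : realType.

(** A relational companion of [mx_deriv], which also asserts that the derivative
    exists, so that the rules of calculus compose. *)
Definition is_mx_deriv m p (F : R -> 'M[R[i]]_(m, p)) (t : R)
    (D : 'M[R[i]]_(m, p)) : Prop :=
  forall i j, is_derive t 1 (fun s => complex.Re (F s i j)) (complex.Re (D i j)) /\
              is_derive t 1 (fun s => complex.Im (F s i j)) (complex.Im (D i j)).

Lemma mx_analytic_deriv m p (F : R -> 'M[R[i]]_(m, p)) t :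
  mx_analytic F -> is_mx_deriv F t (mx_deriv F t).
Proof.
move=> Fan i j; have [Re_an Im_an] := Fan i j; rewrite mxE /= !derive1E.
by split; apply/derivableP; exact: real_analytic_derivable.
Qed.

Lemma is_mx_deriv_unique m p (F : R -> 'M[R[i]]_(m, p)) t D D' :
  is_mx_deriv F t D -> is_mx_deriv F t D' -> D = D'.
Proof.
move=> FD FD'; apply/matrixP => i j.
have [[_ D1] [_ D2]] := FD i j; have [[_ D1'] [_ D2']] := FD' i j.
by apply/eqP; rewrite eq_complex -D1 -D1' -D2 -D2' !eqxx.
Qed.

Lemma is_mx_deriv_affine m p (A B : 'M[R[i]]_(m, p)) t :
  is_mx_deriv (fun s => A + s%:C *: B) t B.
Proof.
move=> i j; split.
- under eq_fun => s do rewrite !mxE ReD ReM /= mul0r subr0.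
  by apply: is_derive_eq; rewrite add0r mul1r scaler0 add0r; exact: mulr1.
- under eq_fun => s do rewrite !mxE ImD ImM /= mul0r addr0.
  by apply: is_derive_eq; rewrite add0r mul1r scaler0 add0r; exact: mulr1.
Qed.

Lemma is_derive_fsum (n : nat) (h : 'I_n -> R -> R) (t : R) (dh : 'I_n -> R) :
  (forall i, is_derive t 1 (h i) (dh i)) ->
  is_derive t 1 (fun s => \sum_i h i s) (\sum_i dh i).
Proof.
by move=> hP; rewrite -fct_sumE; exact: is_derive_sum.
Qed.

Lemma is_mx_deriv_mul m n p (F : R -> 'M[R[i]]_(m, n))
    (G : R -> 'M[R[i]]_(n, p)) t DF DG :
  is_mx_deriv F t DF -> is_mx_deriv G t DG ->
  is_mx_deriv (fun s => F s *m G s) t (DF *m G t + F t *m DG).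
Proof.
move=> FD GD i j.
rewrite !mxE -big_split Re_sum Im_sum /=; split.
- under eq_fun => s do rewrite mxE Re_sum.
  apply: is_derive_fsum => l; have [? ?] := FD i l; have [? ?] := GD l j.
  under eq_fun => s do rewrite ReM.
  apply: is_derive_eq; rewrite ReD !ReM /GRing.scale /=.
  ring.
- under eq_fun => s do rewrite mxE Im_sum.
  apply: is_derive_fsum => l; have [? ?] := FD i l; have [? ?] := GD l j.
  under eq_fun => s do rewrite ImM.
  apply: is_derive_eq; rewrite ImD !ImM /GRing.scale /=.
  ring.
Qed.

Lemma is_derive_rdot m p (F : R -> 'M[R[i]]_(m, p)) t D X :
  is_mx_deriv F t D -> is_derive t 1 (fun s => rdot (F s) X) (rdot D X).
Proof.
move=> FD; under eq_fun => s do rewrite rdotE.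
rewrite rdotE; apply: is_derive_fsum => i; apply: is_derive_fsum => j.
have [? ?] := FD i j; apply: is_derive_eq.
rewrite !scaler0 !add0r /GRing.scale /=; ring.
Qed.

End MatrixDerivative.

(** * The pointwise estimate *)

Section BlockFrames.
Variables (R : realType) (n k : nat) (r : 'I_k -> nat).

(** For a fixed parameter. With [K i j = (U i)^t* *m DU j], the differentiated
    block equation multiplied by [(U i)^t*] reads
    [(U i)^t* *m dA *m U j = K i j *m L j - L i *m K i j] for [i != j], while
    the diagonal block is [DL j] because [K j j = 0]. Parseval on both sides
    writes the squared norm of [dA] as the sum over all blocks, and that of
    [DU j] as the sum of the squared norms of the [K i j]; the gap estimate
    compares them. *)
Lemma offdiag_sylvester_bound (U DU : forall j, 'M[R[i]]_(n, r j))
    (L DL : forall j, 'M[R[i]]_(r j)) (M dA : 'M[R[i]]_n) (d : 'I_k -> R) :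
  M \is hermsymmx ->
  \sum_j U j *m (U j)^t* = 1%:M ->
  (forall j, (U j)^t* *m U j = 1%:M) ->
  (forall i j, i != j -> (U i)^t* *m U j = 0) ->
  (forall j, M *m U j = U j *m L j) ->
  (forall j, dA *m U j + M *m DU j = DU j *m L j + U j *m DL j) ->
  (forall j, (U j)^t* *m DU j = 0) ->
  (forall j, 0 <= d j) ->
  (forall i j, i != j -> ((d j)%:E <= gap (L j) (L i))%E) ->
  \sum_j (frobenius (DL j) ^+ 2 + d j ^+ 2 * frobenius (DU j) ^+ 2)
    <= frobenius dA ^+ 2.
Proof.
rewrite hermsymmxE => /eqP Mh VV UU UU0 MU DE U0 d0 dgap.
have LE j : L j = (U j)^t* *m M *m U j.
  by rewrite -mulmxA MU mulmxA UU mul1mx.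
have Lh j : (L j)^t* = L j.
  by rewrite LE !adjmx_mul trmxCK -Mh !mulmxA.
have UM i : (U i)^t* *m M = L i *m (U i)^t*.
  by rewrite Mh -adjmx_mul MU adjmx_mul Lh.
rewrite -frobenius_adjoint -(frobenius_parseval _ VV); apply: ler_sum => j _.
rewrite -adjmx_mul frobenius_adjoint -(frobenius_parseval (dA *m U j) VV).
rewrite -(frobenius_parseval (DU j) VV) (bigD1 j) //= U0 [leRHS](bigD1 j) //=.
have UdAU i : (U i)^t* *m (dA *m U j) =
    ((U i)^t* *m DU j *m L j - L i *m ((U i)^t* *m DU j)) + (U i)^t* *m U j *m DL j.
  rewrite [L i *m _]mulmxA -UM -!mulmxA -mulmxBr -mulmxDr.
  by rewrite addrAC -DE addrK.
rewrite UdAU U0 mul0mx mulmx0 subrr add0r UU mul1mx lerD2l.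
rewrite -rdotXX {1}/rdot mul0mx linear0 add0r mulr_sumr.
apply: ler_sum => i ij; rewrite UdAU UU0 // mul0mx addr0.
by apply: gap_sylvester; rewrite ?hermsymmxE ?Lh ?dgap.
Qed.

End BlockFrames.

(** * Block frames, the mean value step and infinite gaps *)

Section Assembly.
Variables (R : realType) (k : nat) (r : 'I_k -> nat).

Lemma adjmx_mxrow m (U : forall j, 'M[R[i]]_(m, r j)) :
  (\mxrow_j U j)^t* = \mxcol_j (U j)^t*.
Proof. by apply/matrixP => a b; rewrite !mxE. Qed.

Lemma unitary_mxrow_sum m (U : forall j, 'M[R[i]]_(m, r j)) :
  \mxrow_j U j \is unitarymx -> \sum_j U j *m (U j)^t* = 1%:M.
Proof. by move=> /unitarymxP; rewrite adjmx_mxrow mul_mxrow_mxcol. Qed.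

Lemma unitary_mxrow_orthonormal (U : forall j, 'M[R[i]]_(\sum_j r j, r j)) :
  \mxrow_j U j \is unitarymx ->
  (forall j, (U j)^t* *m U j = 1%:M) /\
  (forall i j, i != j -> (U i)^t* *m U j = 0).
Proof.
move=> /unitarymxPl; rewrite adjmx_mxrow mul_mxcol_mxrow -mxdiagZ /mxdiag.
move=> /eq_mxblockP UU.
by split=> [j|i j /negbTE ij]; rewrite UU ?eqxx ?conform_mx_id ?ij.
Qed.

Lemma adjmx_mxdiag (L : forall j, 'M[R[i]]_(r j)) :
  (\mxdiag_j L j)^t* = \mxdiag_j (L j)^t*.
Proof.
rewrite tr_mxdiag /mxdiag.
transitivity (\mxblock_(i, j) map_mx Num.conj
    (if i == j then conform_mx 0 (L i)^T else 0 : 'M[R[i]]_(r i, r j))).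
  by apply/matrixP => a b; rewrite !mxE.
apply/eq_mxblock => i j; case: eqVneq => [->|_]; last by rewrite map_mx0.
by rewrite !conform_mx_id.
Qed.

Lemma frobenius_mxdiag (L : forall j, 'M[R[i]]_(r j)) :
  frobenius (\mxdiag_j L j) ^+ 2 = \sum_j frobenius (L j) ^+ 2.
Proof.
rewrite -rdotXX /rdot adjmx_mxdiag [X in X *m _]/mxdiag mul_mxblock_mxdiag.
rewrite mxtrace_mxblock Re_sum; apply: eq_bigr => j _.
by rewrite eqxx conform_mx_id -rdotXX.
Qed.

(** Integrating the bound and applying Cauchy-Schwarz in time would give this;
    the mean value theorem suffices. Apply it to the inner product [g] of the
    curve with its own total increment: [g 1 - g 0] is the left-hand side [S],
    and [2 * g' <= B + S] by [rdot_le], whence [S <= B]. *)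
Lemma mean_value_frobenius (m p q : 'I_k -> nat)
    (F DF : forall j, R -> 'M[R[i]]_(m j, r j))
    (G DG : forall j, R -> 'M[R[i]]_(p j, q j))
    (w : 'I_k -> R) (B : R) :
  (forall j t, is_mx_deriv (F j) t (DF j t)) ->
  (forall j t, is_mx_deriv (G j) t (DG j t)) ->
  (forall j, 0 <= w j) ->
  (forall t : R, t \in `]0, 1[ ->
    \sum_j (frobenius (DF j t) ^+ 2 + w j * frobenius (DG j t) ^+ 2) <= B) ->
  \sum_j (frobenius (F j 1 - F j 0) ^+ 2 + w j * frobenius (G j 1 - G j 0) ^+ 2) <= B.
Proof.
move=> FD GD w0 DB; set S := leLHS.
pose g t := \sum_j (rdot (F j t) (F j 1 - F j 0) + w j * rdot (G j t) (G j 1 - G j 0)).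
pose dg t := \sum_j (rdot (DF j t) (F j 1 - F j 0) + w j * rdot (DG j t) (G j 1 - G j 0)).
have gD (t : R) : is_derive t (1 : R) g (dg t).
  apply: is_derive_fsum => j; have ? := is_derive_rdot (F j 1 - F j 0) (FD j t).
  have ? := is_derive_rdot (G j 1 - G j 0) (GD j t).
  by apply: is_derive_eq.
have [c c01] : exists2 c, c \in `]0, 1[ & g 1 - g 0 = dg c * (1 - 0).
  apply: MVT => //; apply: derivable_within_continuous => t _.
  exact: ex_derive.
rewrite subr0 mulr1 => gE.
have gS : g 1 - g 0 = S.
  rewrite /g -sumrB; apply: eq_bigr => j _.
  by rewrite opprD addrACA -mulrBr -!rdotBl !rdotXX.
suff : 2 * dg c <= B + S by rewrite -gE gS mulr_natl mulr2n lerD2r.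
apply: le_trans (lerD (DB c c01) (lexx S)).
rewrite mulr_sumr -big_split ler_sum //= => j _.
rewrite mulrDr [2 * (w j * _)]mulrCA [leRHS]addrACA -[w j * _ + _]mulrDr.
exact: lerD (rdot_le _ _) (ler_wpM2l (w0 j) (rdot_le _ _)).
Qed.

(** Passage from finite weights to [delta_min], which is infinite when there is
    a single block. If [delta j] is infinite, arbitrarily large weights [d j]
    are allowed, which forces [f j = 0]; so the product [+oo * f j] vanishes and
    [d j = fine (delta j)] is a legitimate choice for all [j]. *)
Lemma ereal_weighted_sum_le (delta : 'I_k -> \bar R) (f : 'I_k -> R) (E B : R) :
  0 <= E -> (forall j, 0 <= f j) -> (forall j, 0 <= delta j)%E ->
  (forall d : 'I_k -> R, (forall j, 0 <= d j) ->
     (forall j, (d j)%:E <= delta j)%E -> E + \sum_j d j ^+ 2 * f j <= B) ->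
  (E%:E + \sum_j delta j ^+ 2 * (f j)%:E <= B%:E)%E.
Proof.
move=> E0 f0 delta0 EB.
have foo j : delta j = +oo%E -> f j = 0.
  move=> dj; apply/eqP; rewrite eq_le f0 andbT leNgt; apply/negP => fj.
  have B0 : 0 <= B.
    apply: le_trans (EB (fun=> 0) _ _) => //.
    by rewrite addr_ge0 // sumr_ge0 // => i _; rewrite expr0n mul0r.
  (* [N * f j] exceeds [B], and [1 <= N] gives [N <= N ^+ 2]. *)
  pose N := B / f j + 1; have N1 : 1 <= N by rewrite lerDr divr_ge0.
  have := EB (fun i => if i == j then N else 0); rewrite leNgt => /(_ _ _)/negP; apply.
  - by move=> i; case: ifP => // _; rewrite (le_trans _ N1).
  - by move=> i; case: eqVneq => [->|_] //; rewrite dj leey.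
  rewrite (bigD1 j) //= eqxx big1 ?addr0; last first.
    by move=> i /negbTE ->; rewrite expr0n mul0r.
  rewrite ltr_wpDl //; apply: (@lt_le_trans _ _ (N * f j)).
    by rewrite /N mulrDl divfK ?gt_eqF // ltrDl mul1r.
  by rewrite ler_wpM2r // expr2 ler_peMr // (le_trans _ N1).
have dE j : (delta j ^+ 2 * (f j)%:E = (fine (delta j) ^+ 2 * f j)%:E)%E.
  case: (delta j) (delta0 j) (foo j) => [x|_|] //= /(_ erefl) ->.
  by rewrite mule0 mulr0.
under eq_bigr => j _ do rewrite dE.
rewrite sumEFin -EFinD lee_fin; apply: EB => j; first by rewrite fine_ge0.
by case: (delta j) (delta0 j) => //= _; rewrite leey.
Qed.

Lemma gap_ge0 m p (X : 'M[R[i]]_m) (Y : 'M[R[i]]_p) : (0 <= gap X Y)%E.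
Proof.
apply/ereal_infP => _ [x _ [y _ <-]]; rewrite lee_fin.
by case: (x - y) => a b; exact: sqrtr_ge0.
Qed.

Lemma delta_min_ge0 (L : forall j, R -> 'M[R[i]]_(r j)) j :
  (0 <= delta_min L j)%E.
Proof.
apply/ereal_infP => _ [t _ <-]; apply: le_bigmin => [|i _]; first exact: leey.
exact: gap_ge0.
Qed.

Lemma delta_min_le_gap (L : forall j, R -> 'M[R[i]]_(r j)) i j t :
  t \in `[0, 1] -> i != j -> (delta_min L j <= gap (L j t) (L i t))%E.
Proof.
move=> t01 ij; apply: (@le_trans _ _ (delta L j t)).
  by apply: ereal_inf_lbound; exists t.
exact: bigmin_le_cond.
Qed.

End Assembly.

(** * The perturbation bound *)

Theorem theorem2p1 (R : realType) (n k : nat)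
    (A dA : 'M[R[i]]_n) (r : 'I_k -> nat)
    (U : forall j : 'I_k, R -> 'M[R[i]]_(n, r j))
    (Lambda : forall j : 'I_k, R -> 'M[R[i]]_(r j))
    (A_herm : A \is hermsymmx) (dA_herm : dA \is hermsymmx)
    (k_gt0 : (0 < k)%N)
    (r_gt0 : forall j, (0 < r j)%N)
    (sum_r : (\sum_(j < k) r j)%N = n)
    (U_unitary : forall t, (\mxrow_(j < k) U j t) \is unitarymx)
    (U_analytic : forall j, mx_analytic (U j))
    (Lambda_analytic : forall j, mx_analytic (Lambda j))
    (decomp : forall t : R,
      A + t%:C *: dA =
      (\mxrow_(j < k) U j t) *m (\mxdiag_(j < k) Lambda j t)
        *m (\mxrow_(j < k) U j t)^t*)
    (U_dot : forall j t, (U j t)^t* *m mx_deriv (U j) t = 0) :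
  ((frobenius (eig_down (A + dA) - eig_down A) ^+ 2)%:E
   + \sum_(j < k) delta_min Lambda j ^+ 2
       * (frobenius (U j 1 - U j 0) ^+ 2)%:E
   <= (frobenius dA ^+ 2)%:E)%E.
Proof.
(* Identifying [n] with the sum of the block sizes makes [W t] square. *)
case: _ / sum_r A dA U A_herm dA_herm U_unitary U_analytic decomp U_dot
  => A dA U Ah dAh Uu Uan decomp Udot.
pose W t := \mxrow_(j < k) U j t; pose L t := \mxdiag_(j < k) Lambda j t.
have Wu t : W t \is unitarymx by exact: Uu.
have WW t : (W t)^t* *m W t = 1%:M by exact: unitarymxPl.
have Ath t : A + t%:C *: dA \is hermsymmx.
  move: Ah dAh; rewrite !hermsymmxE => /eqP Ah /eqP dAh; apply/eqP.
  rewrite linearD linearZ /= map_mxD map_mxZ -Ah -dAh.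
  by rewrite -[RHS]/(A + (t%:C)^*%C *: dA) conjc_real.
have AtW t : (A + t%:C *: dA) *m W t = W t *m L t.
  by rewrite decomp -mulmxA WW mulmx1.
have LE t : L t = (W t)^t* *m (A + t%:C *: dA) *m W t.
  by rewrite -mulmxA AtW mulmxA WW mul1mx.
have Lh t : L t \is hermsymmx.
  move: (Ath t); rewrite !hermsymmxE => /eqP At; apply/eqP.
  by rewrite LE !adjmx_mul trmxCK -At !mulmxA.
(* [L t] is unitarily similar to the perturbed matrix, so it can carry the
   eigenvalue term, where Hoffman-Wielandt applies to its total increment. *)
have eigE t : eig_down (A + t%:C *: dA) = eig_down (L t).
  by rewrite !eig_downE LE eig_seq_unitary.
have AU j t : (A + t%:C *: dA) *m U j t = U j t *m Lambda j t.
  move: (AtW t); rewrite /W /L mul_mxrow mul_mxrow_mxdiag.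
  by move=> /eq_mxrowP /(_ j).
have DU j t := mx_analytic_deriv t (Uan j).
have DL j t := mx_analytic_deriv t (Lambda_analytic j).
have DAU j t : dA *m U j t + (A + t%:C *: dA) *m mx_deriv (U j) t =
    mx_deriv (U j) t *m Lambda j t + U j t *m mx_deriv (Lambda j) t.
  apply: (@is_mx_deriv_unique _ _ _ (fun s => U j s *m Lambda j s) t).
    have -> : (fun s => U j s *m Lambda j s) = (fun s => (A + s%:C *: dA) *m U j s).
      by apply/funext => s; rewrite AU.
    by apply: is_mx_deriv_mul; [exact: is_mx_deriv_affine|exact: DU].
  exact: is_mx_deriv_mul.
apply: ereal_weighted_sum_le => [|j|j|d d0 dmin]; rewrite ?sqr_ge0 //.
  exact: delta_min_ge0.
have -> : A + dA = A + 1%:C *: dA by rewrite scale1r.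
have -> : eig_down A = eig_down (A + 0%:C *: dA) by rewrite scale0r addr0.
rewrite !eigE.
apply: le_trans (lerD (hoffman_wielandt (Lh 0) (Lh 1)) (lexx _)) _.
rewrite /L -mxdiagB frobenius_mxdiag -big_split /=.
apply: (mean_value_frobenius DL DU) => [j|t t01]; first exact: sqr_ge0.
have [UU UU0] := unitary_mxrow_orthonormal (Uu t).
apply: (@offdiag_sylvester_bound _ _ _ _ (fun j => U j t) _
  (fun j => Lambda j t) _ (A + t%:C *: dA)) => //.
- exact: unitary_mxrow_sum.
- move=> i j ij; apply: le_trans (dmin j) (delta_min_le_gap _ _ ij).
  exact: subset_itv_oo_cc.
Qed.
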